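(* Let $d,N\ge 1$ be integers, put $s=d-1$, and let $F=F_1+\cdots+F_s+F_d$ and $G=G_1+\cdots+G_N$ be elements of $\mathbb{C}[x_1,\ldots,x_n]$, where $F_i$ and $G_j$ are homogeneous polynomials of degree $i$ and $j$, respectively. Assume that $$F_d=h^d\qquad\text{and}\qquad G_N=a_Nh^N$$ for some homogeneous polynomial $h$ of degree $1$ and some $a_N\in\mathbb{C}\setminus\{0\}$. Let $i\in\{1,\ldots,N\}$. If $\deg[F,G]<d+i$, then there are $a_i,\ldots,a_{N-1}\in\mathbb{C}$ such that for every $j=i,i+1,\ldots,N$ we have $$G_j=\sum_{\substack{\alpha=(\alpha_0,\ldots,\alpha_s)\in\mathbb{Z}\times\mathbb{N}^s\\ \alpha_0+\alpha_1+2\alpha_2+\cdots+s\alpha_s=j\\ \alpha_0+d(\alpha_1+\cdots+\alpha_s)\le N}} c^{(j)}_{\alpha}\,F_1^{\alpha_1}\cdots F_s^{\alpha_s}h^{\alpha_0},$$ where for $\alpha=(\alpha_0,\ldots,\alpha_s)\in\mathbb{Z}\times\mathbb{N}^s$ with $\alpha_0+\alpha_1+2\alpha_2+\cdots+s\alpha_s=j$ and $\alpha_0+d(\alpha_1+\cdots+\alpha_s)\le N$, $$c^{(j)}_{\alpha}=\frac{\prod_{k=1}^{\alpha_1+\cdots+\alpha_s}(\alpha_0+dk)}{\left(\prod_{i_1=1}^{\alpha_1}di_1\right)\cdots\left(\prod_{i_s=1}^{\alpha_s}di_s\right)}\;a_{\alpha_0+d(\alpha_1+\cdots+\alpha_s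)}.$$
   Context: $\mathbb{N}=\{0,1,2,\ldots\}$. For $f,g\in\mathbb{C}[x_1,\ldots,x_n]$ the Poisson bracket is $[f,g]=\sum_{1\le i<j\le n}\left(\frac{\partial f}{\partial x_i}\frac{\partial g}{\partial x_j}-\frac{\partial f}{\partial x_j}\frac{\partial g}{\partial x_i}\right)[x_i,x_j]$, where $[x_i,x_j]=-[x_j,x_i]$ are formal symbols (linearly independent for $i<j$), and $\deg[f,g]=2+\max_{1\le i<j\le n}\deg\left(\frac{\partial f}{\partial x_i}\frac{\partial g}{\partial x_j}-\frac{\partial f}{\partial x_j}\frac{\partial g}{\partial x_i}\right)$, with $\deg 0=-\infty$. A homogeneous component $F_i$ or $G_j$ of lower degree is allowed to be zero. Since $\alpha_0$ may be negative, the identities for $G_j$ are understood in $\mathbb{C}(x_1,\ldots,x_n)$; empty products equal $1$ and $F_l^0=1$ even if $F_l=0$. *)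

(* Defs.v *)
From HB Require Import structures.
From mathcomp Require Import all_boot all_order all_algebra.
From mathcomp Require Import zify.
From mathcomp Require Import mpoly.
From mathcomp Require Import complex.
From mathcomp Require Import boolp classical_sets functions cardinality fsbigop.
From mathcomp Require Import reals constructive_ereal.

Set Implicit Arguments.
Unset Strict Implicit.
Unset Printing Implicit Defensive.

Import Order.TTheory GRing.Theory Num.Theory.

Local Open Scope classical_set_scope.
Local Open Scope ring_scope.

Section Poisson.
Variables (n : nat) (K : fieldType).
Implicit Types (i j : 'I_n) (f g : {mpoly K[n]}) (w : 'M[{mpoly K[n]}]_n).

(* The formal symbol [x_i, x_j]: realized in skew-symmetric matrices, so that
   [x_i, x_j] = - [x_j, x_i] and the symbols with i < j are free. *)
Definition psymbol i j : 'M[{mpoly K[n]}]_n :=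
  delta_mx i j - delta_mx j i.

Definition poisson f g : 'M[{mpoly K[n]}]_n :=
  \sum_(i < n) \sum_(j < n | (i < j)%N)
    (f^`M(i) * g^`M(j) - f^`M(j) * g^`M(i)) *: psymbol i j.

(* msize is the degree plus one, and msize 0 = 0. *)
Definition pdegree f : \bar int :=
  if f == 0 then -oo%E else ((msize f).-1%:Z)%:E.

Definition poisson_degree w : \bar int :=
  (2%:Z%:E + \big[maxe/-oo]_(i < n) \big[maxe/-oo]_(j < n | (i < j)%N)
               pdegree (w i j))%E.

Lemma psymbolC i j : psymbol i j = - psymbol j i.
Proof. by rewrite /psymbol opprB. Qed.

Lemma poissonE f g i j : (i < j)%N ->
  poisson f g i j = f^`M(i) * g^`M(j) - f^`M(j) * g^`M(i).
Proof.
move=> ij; rewrite /poisson summxE (bigD1 i) //= [X in _ + X]big1 ?addr0.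
  rewrite summxE (bigD1 j) //= [X in _ + X]big1 ?addr0.
    rewrite !mxE !eqxx /= (_ : (i == j) = false) ?andbF ?subr0 ?mulr1 //.
    by apply/negbTE; rewrite -val_eqE /= neq_ltn ij.
  move=> l /andP[il lj]; rewrite !mxE eqxx /= [j == l]eq_sym (negbTE lj).
  rewrite (_ : (i == l) = false) ?andbF ?subr0 ?mulr0 //.
  by apply/negbTE; rewrite -val_eqE /= neq_ltn il.
move=> k ki; rewrite summxE big1 // => l kl.
rewrite !mxE [i == k]eq_sym (negbTE ki) /= sub0r.
case: (eqVneq i l) => [il|_] /=; last by rewrite oppr0 mulr0.
case: (eqVneq j k) => [jk|_] /=; last by rewrite oppr0 mulr0.
by move: kl; rewrite -il -jk ltnNge (ltnW ij).
Qed.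

End Poisson.

(* An exponent (alpha_0, (alpha_1, ..., alpha_s)), with s = d - 1; the component
   alpha_(k+1) is [al.2 k] for k : 'I_s. *)
Notation exponent s := (int * {ffun 'I_s -> nat})%type.

Section Exponents.
Variables (s d : nat).
Implicit Types (al : exponent s).

Definition etotal al : nat := (\sum_(k < s) al.2 k)%N.

Definition eweight al : int := al.1 + (\sum_(k < s) k.+1 * al.2 k)%N%:Z.

Definition eindex al : int := al.1 + (d * etotal al)%N%:Z.

Definition ecoef (K : fieldType) (a : int -> K) al : K :=
  (\prod_(1 <= k < (etotal al).+1) (al.1 + (d * k)%N%:Z)%:~R)
  / (\prod_(l < s) \prod_(1 <= m < (al.2 l).+1) (d * m)%:R)
  * a (eindex al).

Definition exponents (N j : nat) : set (exponent s) :=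
  [set al | eweight al = j%:Z /\ eindex al <= N%:Z].

Lemma exponents_total N j al : (s < d)%N -> exponents N j al ->
  (j + etotal al <= N)%N.
Proof.
move=> sd [wal ial].
have : ((\sum_(k < s) k.+1 * al.2 k) + etotal al <= d * etotal al)%N.
  rewrite /etotal big_distrr -big_split /=; apply: leq_sum => k _.
  by rewrite -mulSnr leq_mul2r (leq_trans _ sd) ?orbT // ltnS ltn_ord.
by move: wal ial; rewrite /eweight /eindex; lia.
Qed.

(* Hence the sum over [exponents N j] is an honest finite sum. *)
Lemma finite_exponents N j : (s < d)%N -> finite_set (exponents N j).
Proof.
move=> sd; pose f (u : {ffun 'I_s -> 'I_N.+1}) : exponent s :=
  (j%:Z - (\sum_(k < s) k.+1 * u k)%N%:Z, [ffun k => val (u k)]).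
apply: (@sub_finite_set _ _ (f @` setT)); last first.
  exact/finite_image/finite_finset.
move=> al alP; have tal := exponents_total sd alP.
have leN k : (al.2 k < N.+1)%N.
  by move: tal; rewrite /etotal (bigD1 k) //=; lia.
exists [ffun k => Ordinal (leN k)] => //; case: alP => + _.
rewrite /f /eweight; case: al {tal} leN => a0 u /= leN <-.
have -> : (\sum_(k < s) k.+1 * [ffun k => Ordinal (leN k)] k
           = \sum_(k < s) k.+1 * u k)%N.
  by apply: eq_bigr => k _; rewrite ffunE.
by rewrite addrK; congr pair; apply/ffunP => k; rewrite !ffunE.
Qed.

End Exponents.

(* Main.v *)
(** Let P_j^(m) be the component of degree j of the formal power F^(m/d),
    expanded around its leading term h^m.  The displayed sum is the sum over m
    of a_m P_j^(m), and since F and F^(m/d) have proportional differentials,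
    sum_k [F_k, P_(e-k)^(m)] = 0 for every e.  The degree bound says
    sum_k [F_k, G_(d+j-k)] = 0 for j >= i.  By descending induction on j the
    difference D = G_j - sum_(m > j) a_m P_j^(m) then satisfies
    [h^d, D] = 0, so that D is a homogeneous element of degree j of C[x][1/h]
    whose gradient is parallel to that of h; by Euler's identity D = a_j h^j. *)

Require Import Defs.
From HB Require Import structures.
From mathcomp Require Import all_boot all_order all_algebra.
From mathcomp Require Import ring zify.
From mathcomp Require Import mpoly.
From mathcomp Require Import complex.
From mathcomp Require Import boolp classical_sets functions cardinality fsbigop.
From mathcomp Require Import reals constructive_ereal.

Set Implicit Arguments.
Unset Strict Implicit.
Unset Printing Implicit Defensive.

Import Order.TTheory GRing.Theory Num.Theory.

Local Open Scope classical_set_scope.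
Local Open Scope ring_scope.

(** * Derivations *)

Definition derivation (A : nzRingType) (D : A -> A) :=
  {morph D : x y / x + y} /\ (forall x y, D (x * y) = D x * y + x * D y).

Section DerivationRing.
Variables (A : comNzRingType) (D : A -> A).
Hypothesis derD : derivation D.

Lemma derivD : {morph D : x y / x + y}. Proof. by case: derD. Qed.

Lemma derivM x y : D (x * y) = D x * y + x * D y. Proof. by case: derD. Qed.

Lemma deriv0 : D 0 = 0.
Proof. by apply: (@addrI _ (D 0)); rewrite -derivD !addr0. Qed.

Lemma derivN : {morph D : x / - x}.
Proof. by move=> x; apply: (@addrI _ (D x)); rewrite -derivD !subrr deriv0. Qed.

Lemma derivB : {morph D : x y / x - y}.
Proof. by move=> x y; rewrite derivD derivN. Qed.

Lemma deriv1 : D 1 = 0.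
Proof.
by apply: (@addrI _ (D 1)); rewrite addr0 -{3}[1]mulr1 derivM mulr1 mul1r.
Qed.

Lemma derivXn x k : D (x ^+ k) = k%:R * x ^+ k.-1 * D x.
Proof.
elim: k => [|k IH]; first by rewrite expr0 deriv1 !mul0r.
rewrite exprS derivM IH; case: k {IH} => [|k] /=; first by rewrite expr0; ring.
by rewrite exprS -[k.+2]addn1 natrD; ring.
Qed.

End DerivationRing.

Section DerivationField.
Variables (L : fieldType) (D : L -> L).
Hypothesis derD : derivation D.

Lemma derivXz x z : x != 0 -> D (x ^ z) = z%:~R * x ^ (z - 1) * D x.
Proof.
move=> x0; case: z => k.
  rewrite -exprnP (derivXn derD).
  case: k => [|k]; first by rewrite !mul0r.
  by have -> : Posz k.+1 - 1 = k by lia.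
(* For a negative exponent, differentiate x^(k+1) x^-(k+1) = 1 and solve for the derivative of the
   inverse. *)
have xk0 : x ^+ k.+1 != 0 by rewrite expf_neq0.
have : D (x ^+ k.+1 * (x ^+ k.+1)^-1) = 0 by rewrite divff // (deriv1 derD).
rewrite (derivM derD) (derivXn derD) /= -/(x ^- k.+1) => /eqP.
rewrite addrC addr_eq0 => /eqP e.
have -> : D (x ^ Negz k) = - (k.+1%:R * x ^+ k * D x / x ^+ k.+1) / x ^+ k.+1.
  by rewrite -e mulrC mulKf.
have -> : Negz k - 1 = Negz k.+1 by rewrite !NegzE; lia.
rewrite -[x ^ Negz k.+1]/(x ^- k.+2) NegzE mulrNz -[k.+1%:~R]/(k.+1%:R : L).
rewrite !exprS; field.
by rewrite ?x0 ?expf_neq0.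
Qed.

End DerivationField.

Section QuotientRule.
Variable L : fieldType.
Implicit Types p q a b dp dq da db : L.

(** The second equation is the derivative of the first, with dp, dq, da, db as free letters so that
    [field] applies. It makes the quotient rule independent of the chosen fraction. *)
Lemma quotient_rule_wd p q a b dp dq da db : q != 0 -> b != 0 ->
  p * b = a * q -> dp * b + p * db = da * q + a * dq ->
  (da * b - a * db) / b ^+ 2 = (dp * q - p * dq) / q ^+ 2.
Proof.
move=> q0 b0 e1 e2; have -> : p = a * q / b by rewrite -e1 mulfK.
have -> : dp = (da * q + a * dq - a * q / b * db) / b.
  by rewrite -e2 -e1 mulfK // addrK mulfK.
by field; rewrite q0 b0.
Qed.

Lemma quotient_ruleD p q a b dp dq da db : q != 0 -> b != 0 ->
  ((da * q + a * dq + (dp * b + p * db)) * (b * q)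
     - (a * q + p * b) * (db * q + b * dq)) / (b * q) ^+ 2 =
  (da * b - a * db) / b ^+ 2 + (dp * q - p * dq) / q ^+ 2.
Proof. by move=> q0 b0; field; rewrite q0 b0. Qed.

Lemma quotient_ruleM p q a b dp dq da db : q != 0 -> b != 0 ->
  ((da * p + a * dp) * (b * q) - a * p * (db * q + b * dq)) / (b * q) ^+ 2 =
  (da * b - a * db) / b ^+ 2 * (p / q) + a / b * ((dp * q - p * dq) / q ^+ 2).
Proof. by move=> q0 b0; field; rewrite q0 b0. Qed.

End QuotientRule.

(** * Extension of a derivation to the field of fractions *)

Section FractionDerivation.
Variables (A : idomainType) (D : A -> A).
Hypothesis derD : derivation D.

Lemma fraction_ratio (x : {fraction A}) :
  exists p q, q != 0 /\ x = tofrac p / tofrac q.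
Proof.
elim/quotW: x => x; exists \n_x, \d_x; split; first exact: denom_ratioP.
apply: (@mulIf _ (tofrac \d_x)); first by rewrite tofrac_eq0 denom_ratioP.
rewrite divfK ?tofrac_eq0 ?denom_ratioP //.
(* The remaining equality, x times its denominator equals its numerator, is checked on representing
   pairs. *)
rewrite /GRing.mul /= !piE; apply/eqmodP => /=.
rewrite FracField.equivfE /FracField.mulf.
rewrite !numden_Ratio ?oner_eq0 ?mulf_neq0 ?denom_ratioP ?oner_eq0 //.
by rewrite !mulr1 mulrC.
Qed.

Definition fraction_deriv (x : {fraction A}) : {fraction A} :=
  let p := projT1 (cid (fraction_ratio x)) in
  let q := projT1 (cid (projT2 (cid (fraction_ratio x)))) in
  (tofrac (D p) * tofrac q - tofrac p * tofrac (D q)) / tofrac q ^+ 2.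

Lemma fraction_derivE p q : q != 0 ->
  fraction_deriv (tofrac p / tofrac q) =
    (tofrac (D p) * tofrac q - tofrac p * tofrac (D q)) / tofrac q ^+ 2.
Proof.
rewrite /fraction_deriv; case: cid => a ha /=; case: cid => b [b0 e] /= q0.
have {}e : p * b = a * q.
  apply/eqP; rewrite -tofrac_eq !tofracM; move/eqP: e.
  by rewrite eqr_div ?tofrac_eq0.
have := congr1 (fun x => tofrac (D x)) e; have := congr1 (@tofrac A) e.
rewrite !(derivM derD) !tofracD !tofracM.
by move=> e1 e2; apply: quotient_rule_wd; rewrite ?tofrac_eq0.
Qed.

Lemma fraction_deriv_tofrac p : fraction_deriv (tofrac p) = tofrac (D p).
Proof.
rewrite -[tofrac p]divr1 -tofrac1 fraction_derivE ?oner_neq0 //.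
by rewrite (deriv1 derD) tofrac0 tofrac1 mulr0 subr0 expr1n !divr1 mulr1.
Qed.

Lemma fraction_derivP : derivation fraction_deriv.
Proof.
split=> x y.
  have [a [b [b0 ->]]] := fraction_ratio x.
  have [p [q [q0 ->]]] := fraction_ratio y.
  rewrite addf_div ?tofrac_eq0 // -!tofracM -tofracD !fraction_derivE ?mulf_neq0 //.
  rewrite (derivD derD) !(derivM derD) !(tofracD, tofracM).
  by rewrite quotient_ruleD ?tofrac_eq0.
have [a [b [b0 ->]]] := fraction_ratio x.
have [p [q [q0 ->]]] := fraction_ratio y.
rewrite mulf_div -!tofracM !fraction_derivE ?mulf_neq0 //.
rewrite !(derivM derD) !(tofracD, tofracM).
by rewrite quotient_ruleM ?tofrac_eq0.
Qed.

(* Existential, so that unification never unfolds the choice of a fraction. *)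
Lemma fraction_derivation_extends : exists D' : {fraction A} -> {fraction A},
  derivation D' /\ (forall p, D' (tofrac p) = tofrac (D p)).
Proof.
exists fraction_deriv; split; first exact: fraction_derivP.
exact: fraction_deriv_tofrac.
Qed.

End FractionDerivation.

(** * Homogeneous polynomials with parallel gradients *)

Section HomogeneousGradient.
Variables (n : nat) (K : numFieldType).
Implicit Types (p h : {mpoly K[n]}) (i j a b : 'I_n).

Lemma mderiv_derivation i : derivation (@mderiv n K i).
Proof. by split; [exact: mderivD | exact: mderivM]. Qed.

Lemma dhomog_mderiv k p i : p \is k.-homog -> p^`M(i) \is (k.-1).-homog.
Proof.
move=> /dhomogP hp; apply/dhomogP => m; rewrite mcoeff_msupp mcoeff_deriv => nz.
have <- : mdeg (m + U_(i))%MM = k.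
  by apply: hp; rewrite mcoeff_msupp; apply: contraNneq nz => ->; rewrite mul0rn.
by rewrite mdegD mdeg1 addn1.
Qed.

(** Each monomial is an eigenvector of the Euler operator, with its total degree as eigenvalue. No
    homogeneity is assumed, so the identity also serves for [fppoly]. *)
Lemma mcoeff_euler p (m : 'X_{1..n}) :
  (\sum_(i < n) 'X_i * p^`M(i))@_m = (mdeg m)%:R * p@_m.
Proof.
have -> : \sum_(i < n) 'X_i * p^`M(i) =
    \sum_(k <- msupp p) (mdeg k)%:R *: (p@_k *: 'X_[k]).
  under eq_bigr => i _ do rewrite {1}[p]mpolyE linear_sum mulr_sumr.
  rewrite exchange_big /=; apply: eq_bigr => k _.
  rewrite mdegE natr_sum scaler_suml; apply: eq_bigr => i _.
  rewrite mderivZ mderivX !scalerA -scalerAr mulrC [_%:R * _]mulrC.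
  have [->|m0] := posnP (k i); first by rewrite mulr0 !scale0r.
  by rewrite mulrC -mpolyXD addmC submK // lep1mP -lt0n.
rewrite [in RHS](mpolyE p) !(raddf_sum (mcoeff m)) mulr_sumr; apply: eq_bigr => k _ /=.
by rewrite !mcoeffZ mcoeffX; case: eqP => [->|_] //=; rewrite mulr0n !mulr0.
Qed.

Lemma dhomog_euler k p : p \is k.-homog ->
  \sum_(i < n) 'X_i * p^`M(i) = k%:R *: p.
Proof.
move=> hp; apply/mpolyP => m; rewrite mcoeff_euler mcoeffZ.
have [->//|mk] := eqVneq (mdeg m) k.
by rewrite (dhomog_nemf_coeff hp mk) !mulr0.
Qed.

Lemma dhomog0_mpolyC p : p \is 0.-homog -> p = (p@_0%MM)%:MP.
Proof.
move=> hp; apply/mpolyP => m; rewrite mcoeffC.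
have [->|m0] := eqVneq m 0%MM; first by rewrite mulr1.
by rewrite mulr0; apply: (dhomog_nemf_coeff hp); rewrite mdeg_eq0.
Qed.

(* Euler's identity turns a gradient parallel to that of h into
   k p = h (d_a p) / (d_a h), and d_a p satisfies the same hypothesis. *)
Lemma dhomog_parallel_gradient k p h : h \is 1.-homog -> h != 0 ->
  p \is k.-homog -> (forall i j, h^`M(i) * p^`M(j) = h^`M(j) * p^`M(i)) ->
  exists c, p = c *: h ^+ k.
Proof.
move=> hh h0; pose c i := (h^`M(i))@_0%MM.
have hc i : h^`M(i) = (c i)%:MP by apply/dhomog0_mpolyC/(dhomog_mderiv i hh).
have hE : h = \sum_(i < n) c i *: 'X_i.
  rewrite -[h]scale1r -(dhomog_euler hh); apply: eq_bigr => i _.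
  by rewrite hc mulrC mul_mpolyC.
have [a ca] : exists a, c a != 0.
  apply/existsP; apply: contraNT h0 => /existsPn c0.
  rewrite hE big1 // => i _; move: (c0 i); rewrite negbK => /eqP ->.
  by rewrite scale0r.
elim: k p => [|k IH] p hp par.
  by exists (p@_0%MM); rewrite expr0 alg_mpolyC; exact: dhomog0_mpolyC.
have [|i j|e pe] := IH p^`M(a); first exact: (dhomog_mderiv a hp).
  (* The partial derivatives of h are constants, so they pass through d_a and the parallelism is
     inherited by d_a p. *)
  rewrite !hc !mul_mpolyC -!mderivZ (mderiv_comm a j) (mderiv_comm a i).
  by congr (_^`M(a)); rewrite !mderivZ -!mul_mpolyC -!hc.
(* Euler's identity gives (k+1) c_a p = sum_b X_b c_a d_b p = sum_b X_b c_b d_a p = h d_a p = e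
   h^(k+1). *)
exists ((k.+1%:R * c a)^-1 * e).
have k0 : k.+1%:R * c a != 0 by rewrite mulf_neq0 // pnatr_eq0.
rewrite -scalerA exprS scalerAr -pe; apply: (scalerI k0).
rewrite scalerA divff // scale1r mulrC -scalerA -(dhomog_euler hp) scaler_sumr.
rewrite {1}hE mulr_suml; apply: eq_bigr => b _.
by rewrite -!mul_mpolyC -!hc mulrCA par !mulrA [_ * 'X_b]mulrC.
Qed.

End HomogeneousGradient.

(** * Fractional powers *)

Section FractionalPower.
Variables (s : nat) (K : numFieldType).
Implicit Types (al : 'X_{1..s}) (k : 'I_s) (m w : int).
Local Notation d := s.+1.

(* 'X_k stands for F_(k+1) / h^d, whose degree is k + 1 - d = - (s - k). *)
Definition mcodeg al : nat := (\sum_(k < s) (s - k) * al k)%N.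

(* The coefficient of 'X^al in (1 + sum_k 'X_k)^(m/d), where
   m - d |al| plays the part of alpha_0. *)
Definition fpcoef m al : K :=
  (\prod_(1 <= t < (mdeg al).+1) (m - (d * mdeg al)%N%:Z + (d * t)%N%:Z)%:~R)
  / (\prod_(k < s) \prod_(1 <= t < (al k).+1) (d * t)%:R).

(** The part of weight [w] of (1 + sum_k 'X_k)^(m/d), where 'X_k has weight s - k. All weights are
    at least 1, so a monomial of weight [w] has degree at most |w| and the bounded index set misses
    none. *)
Definition fppoly m w : {mpoly K[s]} :=
  \sum_(al : 'X_{1..s < `|w|.+1})
    (if (mcodeg al)%:Z == w then fpcoef m al else 0) *: 'X_[al].

Lemma mcodegD al be : mcodeg (al + be) = (mcodeg al + mcodeg be)%N.
Proof.
by rewrite /mcodeg -big_split; apply: eq_bigr => k _; rewrite mnmDE mulnDr.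
Qed.

Lemma mcodeg1 k : mcodeg U_(k) = (s - k)%N.
Proof.
rewrite /mcodeg (bigD1 k) //= big1 ?addn0 ?mnm1E ?eqxx ?muln1 // => l lk.
by rewrite mnm1E eq_sym (negbTE lk) muln0.
Qed.

Lemma mdeg_le_mcodeg al : (mdeg al <= mcodeg al)%N.
Proof.
by rewrite mdegE; apply: leq_sum => k _; rewrite leq_pmull // subn_gt0.
Qed.

Lemma mcoeff_fppoly_sum b m w al : (`|w| < b)%N ->
  (\sum_(be : 'X_{1..s < b})
    (if (mcodeg be)%:Z == w then fpcoef m be else 0) *: 'X_[be])@_al =
  if (mcodeg al)%:Z == w then fpcoef m al else 0.
Proof.
move=> wb; have [le|lt] := ltnP (mdeg al) b; first exact: (mcoeff_mpoly (R := K)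
    (fun be => if (mcodeg be)%:Z == w then fpcoef m be else 0) le).
rewrite ifN; last first.
  apply: contraTneq lt => wE; rewrite -ltnNge (leq_ltn_trans _ wb) //.
  by rewrite -wE absz_nat mdeg_le_mcodeg.
rewrite (raddf_sum (mcoeff al)) big1 // => be _; rewrite /= mcoeffZ mcoeffX.
case: (bmnm be =P al) => [e|_]; last by rewrite mulr0n mulr0.
by move: (bmdeg be) lt; rewrite e ltnNge => /negbTE ->.
Qed.

Lemma mcoeff_fppoly m w al :
  (fppoly m w)@_al = if (mcodeg al)%:Z == w then fpcoef m al else 0.
Proof. exact: mcoeff_fppoly_sum. Qed.

(** A bound independent of [w] is what allows the two sums in [fppart_sumE] to be exchanged. *)
Lemma fppoly_widen b m w : (`|w| < b)%N ->
  fppoly m w = \sum_(be : 'X_{1..s < b})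
    (if (mcodeg be)%:Z == w then fpcoef m be else 0) *: 'X_[be].
Proof.
by move=> wb; apply/mpolyP => al; rewrite mcoeff_fppoly mcoeff_fppoly_sum.
Qed.

(** Coefficientwise, with y = 1 + sum_k 'X_k: the derivative of y^(m/d) along 'X_k is (m/d)
    y^((m-d)/d). *)
Lemma fpcoefD1 m al k :
  fpcoef m (al + U_(k))%MM *+ (al k).+1 = m%:~R / d%:R * fpcoef (m - d%:Z) al.
Proof.
(* The last factor of the longer numerator is m; the others form the numerator for m - d. *)
rewrite /fpcoef mdegD mdeg1 addn1 big_nat_recr //=.
rewrite -[X in X * _ / _](_ : \prod_(1 <= t < (mdeg al).+1)
  (m - d%:Z - (d * mdeg al)%N%:Z + (d * t)%N%:Z)%:~R = _); last first.
  by apply: eq_bigr => t _; congr (_%:~R); lia.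
rewrite subrK; set X := \prod_(1 <= t < _) _.
rewrite (bigD1 k) //= [in RHS](bigD1 k) //= mnmDE mnm1E eqxx addn1.
rewrite big_nat_recr //= natrM.
rewrite [X in _ / (_ * X)](eq_bigr
    (fun l : 'I_s => \prod_(1 <= t < (al l).+1) (d * t)%:R)); last first.
  by move=> l lk; rewrite mnmDE mnm1E eq_sym (negbTE lk) addn0.
have pr0 (u : nat) : \prod_(1 <= t < u.+1) (d * t)%:R != 0 :> K.
  rewrite prodf_seq_neq0; apply/allP => t; rewrite mem_index_iota => /andP[t0 _].
  by rewrite pnatr_eq0 muln_eq0 /= -lt0n.
set Y := \prod_(i < s | _) _.
have Y0 : Y != 0 by apply/prodf_neq0.
rewrite -mulr_natr; field.
by rewrite Y0 pr0 !nat1r !pnatr_eq0.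
Qed.

(** With f t = m - dr + dt and r = |al|, both numerators become f 0 f 1 ... f r: the left factor
    supplies f 0, the right one f r. *)
Lemma fpcoef_shift m al :
  (m%:~R - d%:R * (mdeg al)%:R) * fpcoef m al = m%:~R * fpcoef (m - d%:Z) al.
Proof.
rewrite /fpcoef !mulrA; congr (_ / _); set r := mdeg al.
pose f t : K := (m - (d * r)%N%:Z + (d * t)%N%:Z)%:~R.
have -> : m%:~R - d%:R * r%:R = f 0%N.
  by rewrite /f muln0 addr0 rmorphB /= -natrM.
have mE : m%:~R = f r by rewrite /f subrK.
rewrite -[in LHS]/(\prod_(1 <= t < r.+1) f t) -big_ltn // big_nat_recr //=.
rewrite mulrC -mE; congr (_ * _); rewrite [in RHS]big_add1 /=.
by apply: eq_bigr => t _; rewrite /f; congr (_%:~R); lia.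
Qed.

Lemma mderiv_fppoly m w k :
  (fppoly m w)^`M(k) = (m%:~R / d%:R) *: fppoly (m - d%:Z) (w - (s - k)%N%:Z).
Proof.
apply/mpolyP => al; rewrite mcoeff_deriv mcoeffZ !mcoeff_fppoly.
rewrite mcodegD mcodeg1 PoszD -[in RHS](inj_eq (addIr (s - k)%N%:Z)) subrK.
by case: ifP => _; rewrite ?fpcoefD1 // mul0rn mulr0.
Qed.

(** With y = 1 + S and S = sum_k 'X_k, this is the part of weight [w] of m y^(m/d) - m S y^(m/d-1) =
    m y^(m/d-1). *)
Lemma euler_fppoly m w :
  m%:~R *: fppoly m w
    - d%:R *: (\sum_(k < s) 'X_k * (fppoly m w)^`M(k)) =
  m%:~R *: fppoly (m - d%:Z) w.
Proof.
apply/mpolyP => al; rewrite mcoeffB !mcoeffZ mcoeff_euler !mcoeff_fppoly.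
rewrite mulrA -mulrBl; case: ifP => _; last by rewrite !mulr0.
exact: fpcoef_shift.
Qed.

Lemma fppoly_lt0 m w : w < 0 -> fppoly m w = 0.
Proof.
by move=> w0; apply/mpolyP => al; rewrite mcoeff_fppoly mcoeff0 ifN //; lia.
Qed.

Lemma fppoly0 m : fppoly m 0 = 1.
Proof.
apply/mpolyP => al; rewrite mcoeff_fppoly mcoeff1 eqz_nat.
have [->|al0] := eqVneq al 0%MM.
  rewrite ifT; last by rewrite /mcodeg big1 // => k _; rewrite mnm0E muln0.
  rewrite /fpcoef mdeg0 big_geq // big1 ?divr1 // => k _.
  by rewrite mnm0E big_geq.
rewrite ifN // -lt0n (leq_trans _ (mdeg_le_mcodeg al)) // lt0n.
by rewrite mdeg_eq0.
Qed.

End FractionalPower.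

(** * Homogeneous components of F^(m/d) and their derivatives *)

Section FractionalPowerPart.
Variables (s : nat) (K : numFieldType) (L : fieldType).
Variables (iota : {rmorphism K -> L}) (h : L) (f : nat -> L).
Hypotheses (h0 : h != 0) (fd : f s.+1 = h ^+ s.+1).
Implicit Types (j m : int) (k : 'I_s) (p q : {mpoly K[s]}).
Local Notation d := s.+1.

Let u k := f k.+1 / h ^+ d.

(* The component of degree j of F^(m/d) = h^m (1 + sum_k f_k / h^d)^(m/d). *)
Definition fppart m j : L := h ^ m * mmap iota u (fppoly s K m (m - j)).

Lemma fppart_gt m j : m < j -> fppart m j = 0.
Proof. by move=> mj; rewrite /fppart fppoly_lt0 ?mmap0 ?mulr0 ?subr_lt0. Qed.

Lemma fppart_diag m : fppart m m = h ^ m.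
Proof. by rewrite /fppart subrr fppoly0 rmorph1 mulr1. Qed.

Section OneDerivation.
Variable D : L -> L.
Hypotheses (derD : derivation D) (D_iota : forall c, D (iota c) = 0).

(** The chain rule: it holds for constants and variables and is stable under sums and products. *)
Lemma deriv_mmap (v : 'I_s -> L) p :
  D (mmap iota v p) = \sum_(k < s) mmap iota v p^`M(k) * D (v k).
Proof.
pose P q := D (mmap iota v q) = \sum_(k < s) mmap iota v q^`M(k) * D (v k).
have PC c : P c%:MP.
  rewrite /P mmapC D_iota big1 // => k _.
  by rewrite mderivC mmap0 mul0r.
have PD q r : P q -> P r -> P (q + r).
  rewrite /P mmapD (derivD derD) => -> ->; rewrite -big_split /=.
  by apply: eq_bigr => k _; rewrite mderivD mmapD mulrDl.
have PM q r : P q -> P r -> P (q * r).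
  rewrite /P rmorphM (derivM derD) => -> ->.
  rewrite mulr_suml mulr_sumr -big_split /=; apply: eq_bigr => k _.
  rewrite mderivM mmapD !rmorphM /=.
  by ring.
have PX k : P 'X_k.
  rewrite /P mmapX mmap1U (bigD1 k) //= big1 => [|l lk].
    rewrite mderivX mnm1E eqxx scale1r addr0 -[X in 'X_[X]](_ : 0%MM = _).
      by rewrite mpolyX0 rmorph1 mul1r.
    by apply/mnmP => l; rewrite mnmBE mnm0E subnn.
  by rewrite mderivX mnm1E eq_sym (negbTE lk) scale0r mmap0 mul0r.
rewrite [p]mpolyE -/(P _); apply: (big_ind P) => [|//|al _]; first exact: (PC 0).
rewrite -mul_mpolyC; apply: (PM _ _ (PC _)); rewrite mpolyXE_id.
apply: (big_ind P) => [|//|k _]; first exact: (PC 1).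
elim: (al k) => [|e IH]; first exact: (PC 1).
by rewrite exprS; apply: PM.
Qed.

(** The component of degree j of D(F^(m/d)) = (m/d) F^((m-d)/d) D(F). *)
Lemma deriv_fppart m j :
  D (fppart m j) =
  iota (m%:~R / d%:R) *
    \sum_(1 <= k < d.+1) fppart (m - d%:Z) (j - k%:Z) * D (f k).
Proof.
have hd0 : h ^+ d != 0 by rewrite expf_neq0.
have dn0 : iota d%:R != 0 by rewrite fmorph_eq0 pnatr_eq0.
pose E p := mmap iota u p.
have hz z : h ^ (z - d%:Z) = h ^ z / h ^+ d.
  by rewrite expfzDr // -exprnN.
have Eu k : E 'X_k = u k by rewrite /E mmapX mmap1U.
set w := m - j.
have Du k : D (u k) = D (f k.+1) / h ^+ d - iota d%:R * u k * (D h / h).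
  rewrite /u (derivM derD) -[_^-1]/(h ^- d) exprnN (derivXz derD _ h0).
  rewrite rmorph_nat mulrNz.
  have -> : h ^ (- d%:Z - 1) = (h ^+ d)^-1 / h.
    by rewrite expfzDr // -exprnN -expr1z -exprnN expr1.
  by rewrite -[d%:~R]/(d%:R) -!exprnN; field; rewrite h0 hd0.
rewrite big_nat_recr //= fd (derivXn derD) /=.
have -> : fppart (m - d%:Z) (j - d%:Z) = h ^ m / h ^+ d * E (fppoly s K (m - d%:Z) w).
  by rewrite /fppart hz; congr (_ * mmap _ _ (fppoly _ _ _ _)); rewrite /w; lia.
have DE : D (E (fppoly s K m w)) =
   \sum_(k < s) E (fppoly s K m w)^`M(k) / h ^+ d * D (f k.+1)
   - iota d%:R * (\sum_(k < s) E 'X_k * E (fppoly s K m w)^`M(k)) * (D h / h).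
  have dE q : D (E q) = \sum_(k < s) E q^`M(k) * D (u k) := deriv_mmap u q.
  rewrite dE mulr_sumr mulr_suml -sumrB; apply: eq_bigr => k _.
  by rewrite Du Eu; field; rewrite h0 hd0.
(* This collects the terms in D h / h, which come both from h^m and from the denominators h^d of the
   u_k. *)
have eul : iota m%:~R * E (fppoly s K m w) -
    iota d%:R * (\sum_(k < s) E 'X_k * E (fppoly s K m w)^`M(k)) =
    iota m%:~R * E (fppoly s K (m - d%:Z) w).
  rewrite /E -!mmapZ -euler_fppoly mmapB !mmapZ; congr (_ - _ * _).
  by rewrite raddf_sum; apply: eq_bigr => k _; rewrite /= rmorphM.
rewrite /fppart -/w -/(E _) (derivM derD) (derivXz derD _ h0) DE.
have -> : h ^ (m - 1) = h ^ m / h by rewrite expfzDr // -expr1z -exprnN.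
rewrite -[m%:~R](rmorph_int iota).
have -> : iota m%:~R * (h ^ m / h) * D h * E (fppoly s K m w) +
  h ^ m * (\sum_(k < s) E (fppoly s K m w)^`M(k) / h ^+ d * D (f k.+1) -
    iota d%:R * (\sum_(k < s) E 'X_k * E (fppoly s K m w)^`M(k)) * (D h / h))
  = h ^ m * (\sum_(k < s) E (fppoly s K m w)^`M(k) / h ^+ d * D (f k.+1))
   + h ^ m * (iota m%:~R * E (fppoly s K (m - d%:Z) w)) * (D h / h).
  by rewrite -eul; ring.
(* The terms in D h give the summand k = d; the others match through [mderiv_fppoly]. *)
rewrite mulrDr; congr (_ + _); last first.
  rewrite fmorph_div -(rmorph_nat iota) exprS.
  move: (iota d%:R) dn0 => c c0.
  by field; rewrite h0 c0 expf_neq0.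
rewrite big_add1 /= big_mkord !mulr_sumr; apply: eq_bigr => k _.
rewrite mderiv_fppoly /E mmapZ hz.
have -> : m - d%:Z - (j - k.+1%:Z) = w - (s - k)%N%:Z.
  by rewrite /w; have := ltn_ord k; lia.
by ring.
Qed.

End OneDerivation.

(** The component of [F, F^(m/d)] = 0 indexed by e. After [deriv_fppart] both halves are double sums
    over k and l whose middle factor depends on k + l only, and they agree after exchanging k and
    l. *)
Lemma bracket_fppart (D D' : L -> L) m (e : int) :
  derivation D -> derivation D' ->
  (forall c, D (iota c) = 0) -> (forall c, D' (iota c) = 0) ->
  \sum_(1 <= k < d.+1)
    (D (f k) * D' (fppart m (e - k%:Z)) - D' (f k) * D (fppart m (e - k%:Z))) = 0.
Proof.
move=> dD dD' D0 D'0.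
pose X (k l : nat) := D (f k) * (iota (m%:~R / d%:R) *
   (fppart (m - d%:Z) (e - k%:Z - l%:Z) * D' (f l))).
rewrite sumrB [X in X - _](_ : _ = \sum_(1 <= k < d.+1) \sum_(1 <= l < d.+1) X k l).
  rewrite [X in _ - X](_ : _ = \sum_(1 <= k < d.+1) \sum_(1 <= l < d.+1) X l k).
    by rewrite exchange_big subrr.
  apply: eq_bigr => k _; rewrite deriv_fppart // !mulr_sumr; apply: eq_bigr => l _.
  by rewrite /X addrAC; ring.
apply: eq_bigr => k _; rewrite deriv_fppart // !mulr_sumr.
by apply: eq_bigr => l _.
Qed.

End FractionalPowerPart.

(** * Homogeneous Laurent elements *)

Section LaurentHomogeneous.
Variables (n : nat) (K : numFieldType) (h : {mpoly K[n]}).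
Hypotheses (hh : h \is 1.-homog) (h0 : h != 0).
Local Notation P := {mpoly K[n]}.
Local Notation L := {fraction P}.
Implicit Types (e z : int) (x y : L) (p : P).

Definition fracC : K -> L := @tofrac P \o @mpolyC n K.
HB.instance Definition _ := GRing.RMorphism.on fracC.

Definition fderiv (i : 'I_n) : L -> L :=
  projT1 (cid (fraction_derivation_extends (mderiv_derivation K i))).

Lemma fderiv_derivation i : derivation (fderiv i).
Proof. by rewrite /fderiv; case: cid => D []. Qed.

Lemma fderiv_tofrac i p : fderiv i (tofrac p) = tofrac p^`M(i).
Proof. by rewrite /fderiv; case: cid => D []. Qed.

Lemma fderivC i c : fderiv i (fracC c) = 0.
Proof. by rewrite /fracC /= fderiv_tofrac mderivC tofrac0. Qed.

Local Notation H := (tofrac h).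

Let H0 : H != 0. Proof. by rewrite tofrac_eq0. Qed.

Let homogX k : h ^+ k \is k.-homog.
Proof. by rewrite -[X in _ \is X.-homog]mul1n dhomogMn. Qed.

(** Homogeneous elements of degree [e] of K[x][1/h]; relating the degrees in the integers admits
    negative [e]. *)
Definition laurent_homog e x := exists (M k : nat) (p : P),
  [/\ k%:Z = e + M%:Z, p \is k.-homog & x = tofrac p / H ^+ M].

Lemma laurent_homog_tofrac k p : p \is k.-homog -> laurent_homog k (tofrac p).
Proof. by move=> hp; exists 0%N, k, p; rewrite addr0 expr0 divr1. Qed.

Lemma laurent_homog0 e : laurent_homog e 0.
Proof.
(* The denominator h^|e| makes the degree e + |e| of the numerator nonnegative. *)
exists (absz e), (absz (e + (absz e)%:Z)), 0; rewrite dhomog0 tofrac0 mul0r; split=> //.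
by lia.
Qed.

Lemma laurent_homogM e z x y :
  laurent_homog e x -> laurent_homog z y -> laurent_homog (e + z) (x * y).
Proof.
move=> [M [k [p [ek hp ->]]]] [M' [k' [q [ek' hq ->]]]].
exists (M + M')%N, (k + k')%N, (p * q); split; first by rewrite !PoszD; lia.
  exact: dhomogM.
by rewrite mulf_div exprD tofracM.
Qed.

Lemma laurent_homogD e x y :
  laurent_homog e x -> laurent_homog e y -> laurent_homog e (x + y).
Proof.
move=> [M [k [p [ek hp ->]]]] [M' [k' [q [ek' hq ->]]]].
exists (M + M')%N, (k + M')%N, (p * h ^+ M' + q * h ^+ M); split.
- by rewrite !PoszD; lia.
- apply: rpredD; first exact: dhomogM.
  have -> : (k + M' = k' + M)%N by lia.
  exact: dhomogM.
by rewrite addf_div ?expf_neq0 // exprD tofracD !tofracM !tofracXn.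
Qed.

Lemma laurent_homogN e x : laurent_homog e x -> laurent_homog e (- x).
Proof.
move=> [M [k [p [ek hp ->]]]]; exists M, k, (- p).
by rewrite dhomogN tofracN mulNr.
Qed.

Lemma laurent_homogC c : laurent_homog 0 (fracC c).
Proof.
apply: (laurent_homog_tofrac (k := 0)); rewrite -alg_mpolyC.
exact/dhomogZ/dhomog1.
Qed.

Lemma laurent_homogZ e c x : laurent_homog e x -> laurent_homog e (fracC c * x).
Proof. by move=> hx; rewrite -[e]add0r; apply: laurent_homogM (laurent_homogC c) hx. Qed.

Lemma laurent_homog_exprz z : laurent_homog z (H ^ z).
Proof.
case: z => k; first by rewrite -exprnP -tofracXn; apply/laurent_homog_tofrac.
exists k.+1, 0%N, 1; split; [by rewrite NegzE; lia | exact: dhomog1 |].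
by rewrite tofrac1 div1r.
Qed.

Lemma laurent_homogX e x k : laurent_homog e x -> laurent_homog (e * k%:Z) (x ^+ k).
Proof.
move=> hx; elim: k => [|k IH].
  by rewrite mulr0 expr0 -tofrac1; apply/(laurent_homog_tofrac (k := 0))/dhomog1.
by rewrite exprS intS mulrDr mulr1; apply: laurent_homogM.
Qed.

Lemma laurent_homog_sum (I : Type) (r : seq I) (Q : pred I) e (F : I -> L) :
  (forall i, Q i -> laurent_homog e (F i)) ->
  laurent_homog e (\sum_(i <- r | Q i) F i).
Proof.
move=> hF; apply: (big_ind (laurent_homog e)) => //; first exact: laurent_homog0.
exact: laurent_homogD.
Qed.

Lemma laurent_homog_prod (I : Type) (r : seq I) (e : I -> int) (F : I -> L) :
  (forall i, laurent_homog (e i) (F i)) ->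
  laurent_homog (\sum_(i <- r) e i) (\prod_(i <- r) F i).
Proof.
move=> hF; elim: r => [|i r IH].
  by rewrite !big_nil -tofrac1; apply/(laurent_homog_tofrac (k := 0))/dhomog1.
by rewrite !big_cons; apply: laurent_homogM.
Qed.

(** The gradient of x h^M is h^M grad x plus a multiple of grad h, so clearing the denominator
    preserves parallelism and reduces to polynomials. *)
Lemma laurent_parallel_gradient e x : laurent_homog e x ->
  (forall i j, fderiv i H * fderiv j x = fderiv j H * fderiv i x) ->
  exists c, x = fracC c * H ^ e.
Proof.
move=> [M [k [p [ek hp xE]]]] par.
have pE : tofrac p = x * H ^+ M by rewrite xE (divfK (expf_neq0 M H0)).
have [i j|c pc] := dhomog_parallel_gradient hh h0 hp.
  apply/eqP; rewrite -tofrac_eq !tofracM -!fderiv_tofrac pE.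
  rewrite !(derivM (fderiv_derivation _)) !(derivXn (fderiv_derivation _)).
  by apply/eqP; rewrite !mulrDr !mulrA par; ring.
exists c; rewrite xE pc -mul_mpolyC tofracM tofracXn -mulrA; congr (_ * _).
have -> : e = k%:Z - M%:Z by lia.
by rewrite expfzDr // -exprnN.
Qed.

(** The weight s - k of 'X_k is minus the degree of f_(k+1) / h^d, so weight m - j contributes
    degree j - m, and h^m restores j. *)
Lemma laurent_homog_fppart s (f : nat -> L) (m j : int) :
  (forall k : 'I_s, laurent_homog k.+1 (f k.+1)) ->
  laurent_homog j (fppart s fracC H f m j).
Proof.
move=> hf; rewrite /fppart /fppoly.
rewrite -[X in laurent_homog X](subrK m) addrC.
apply: laurent_homogM; first exact: laurent_homog_exprz.
rewrite raddf_sum; apply: laurent_homog_sum => al _ /=.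
rewrite mmapZ; case: eqP => [ae|_]; last first.
  by rewrite rmorph0 mul0r; apply: laurent_homog0.
rewrite mmapX; apply: laurent_homogZ; move: (bmnm al) ae => {}al ae.
have -> : j - m = \sum_(k < s) (k.+1%:Z - s.+1%:Z) * (al k)%:Z.
  rewrite -opprB -ae /mcodeg (big_morph Posz PoszD (erefl _)) -sumrN.
  apply: eq_bigr => k _; rewrite PoszM -mulNr; congr (_ * _).
  by have := ltn_ord k; lia.
apply: laurent_homog_prod => k; apply: laurent_homogX.
by apply: laurent_homogM (hf k) _; rewrite exprnN; apply: laurent_homog_exprz.
Qed.

End LaurentHomogeneous.

Arguments fracC {n K}.

(** * Descending induction on the components of G *)

Section DescendingInduction.
Variables (n : nat) (K : numFieldType) (s N : nat).
Variables (Fc Gc : nat -> {mpoly K[n]}) (h : {mpoly K[n]}) (aN : K).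
Local Notation d := s.+1.
Local Notation H := (tofrac h).
Local Notation f k := (tofrac (Fc k)).
Hypotheses (hh : h \is 1.-homog) (h0 : h != 0).
Hypotheses (hFc : forall k, (1 <= k <= d)%N -> Fc k \is k.-homog).
Hypotheses (hFd : Fc d = h ^+ d).

Local Notation part m j := (fppart s (@fracC n K) H (fun k => f k) m j).

Let H0 : H != 0. Proof. by rewrite tofrac_eq0. Qed.

Let fd : f d = H ^+ d. Proof. by rewrite hFd tofracXn. Qed.

(** The index d + j - k may exceed N, where nothing is known about [Gc]; there the component of G is
    zero. *)
Let g l := if (1 <= l <= N)%N then Gc l else 0.

Let br i j (x y : {fraction {mpoly K[n]}}) :=
  fderiv i x * fderiv j y - fderiv j x * fderiv i y.

Let br0 i j x : br i j x 0 = 0.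
Proof. by rewrite /br !(deriv0 (@fderiv_derivation n K _)) !mulr0 subrr. Qed.

Let brD i j x : {morph br i j x : y z / y + z}.
Proof. by move=> y z; rewrite /br !(derivD (@fderiv_derivation n K _)); ring. Qed.

Let brB i j x : {morph br i j x : y z / y - z}.
Proof. by move=> y z; rewrite /br !(derivB (@fderiv_derivation n K _)); ring. Qed.

Let brZ i j c x y : br i j x (fracC c * y) = fracC c * br i j x y.
Proof.
by rewrite /br !(derivM (@fderiv_derivation n K _)) !fderivC; ring.
Qed.

Lemma component_eq_fppart_sum (i : nat) :
  (1 <= i <= N)%N -> Gc N = aN *: h ^+ N ->
  (forall k, (1 <= k <= N)%N -> Gc k \is k.-homog) ->
  (forall j, (i <= j)%N -> forall a b : 'I_n,
    \sum_(1 <= k < d.+1) ((Fc k)^`M(a) * (g (d + j - k))^`M(b)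
                          - (Fc k)^`M(b) * (g (d + j - k))^`M(a)) = 0) ->
  exists a : int -> K, a N%:Z = aN /\
    forall j : nat, (i <= j <= N)%N ->
      tofrac (Gc j) =
        \sum_(j <= m < N.+1) fracC (a m%:Z) * part m%:Z j%:Z.
Proof.
move=> /andP[i0 iN] hGN hGc hbr.
(* Induction on t, the formula being known for the top components of degrees N - t to N. *)
suff: forall t, (t <= N - i)%N -> exists a : int -> K, a N%:Z = aN /\
    forall j : nat, (N - t <= j <= N)%N -> tofrac (Gc j) =
        \sum_(j <= m < N.+1) fracC (a m%:Z) * part m%:Z j%:Z.
  by move=> /(_ _ (leqnn _)); rewrite subKn.
elim=> [_|t IH tN].
  exists (fun=> aN); split=> // j; rewrite subn0 => jN.
  have -> : j = N by lia.
  rewrite big_nat1 fppart_diag hGN -mul_mpolyC tofracM tofracXn.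
  by rewrite -exprnP.
have {IH} [a [aNE ga]] := IH (ltnW tN).
pose j := (N - t.+1)%N; have ij : (i <= j)%N by rewrite /j; lia.
have jN : (j < N)%N by rewrite /j; lia.
pose T (l : int) := \sum_(j.+1 <= m < N.+1) fracC (a m%:Z) * part m%:Z l.
(* The terms with m < l vanish since F^(m/d) has no component of degree above m; for l > N this
   kills all of them. *)
have gT l : (j < l)%N -> tofrac (g l) = T l%:Z.
  move=> jl; rewrite /g; case: ifP => lN.
    rewrite ga; last by move: lN jl; rewrite /j; lia.
    rewrite /T (@big_cat_nat _ _ _ l j.+1) //=; last by lia.
    rewrite [X in X + _]big_nat_cond [X in X + _]big1 ?add0r //.
    move=> m /andP[/andP[_ ml] _].
    by rewrite fppart_gt ?mulr0 // ltz_nat.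
  rewrite tofrac0 /T big_nat_cond big1 // => m /andP[/andP[jm mN] _].
  by rewrite fppart_gt ?mulr0 // ltz_nat; lia.
have brT u v : \sum_(1 <= k < d.+1) br u v (f k) (T ((d + j)%N%:Z - k%:Z)) = 0.
  under eq_bigr => k _.
    rewrite /T (big_morph _ (brD u v (f k)) (br0 u v (f k))).
    under eq_bigr => m _ do rewrite brZ.
    over.
  rewrite exchange_big /= big1 // => m _; rewrite -mulr_sumr.
  by rewrite bracket_fppart ?mulr0 //;
    [exact: fderiv_derivation | exact: fderiv_derivation
    | move=> c; exact: fderivC | move=> c; exact: fderivC].
have brg u v : \sum_(1 <= k < d.+1) br u v (f k) (tofrac (g (d + j - k))) = 0.
  have := congr1 (@tofrac _) (hbr j ij u v).
  rewrite tofrac0 (raddf_sum (@tofrac _)) => e; apply: etrans e.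
  by apply: eq_bigr => k _; rewrite /= tofracB !tofracM /br !fderiv_tofrac.
(* For k < d the index d + j - k exceeds j, so the two vanishing sums agree there by [gT]; only
   their summands at k = d remain. *)
have brx u v : br u v (f d) (tofrac (Gc j) - T j%:Z) = 0.
  have := etrans (brT u v) (esym (brg u v)); rewrite big_nat_recr //=.
  rewrite [in RHS]big_nat_recr //= addKn.
  have -> : (d + j)%N%:Z - d%:Z = j%:Z by lia.
  have -> : g j = Gc j by rewrite /g ifT //; lia.
  rewrite (eq_big_nat _ _ (F2 := fun k => br u v (f k) (tofrac (g (d + j - k))))).
    by move=> /addrI e; rewrite brB e subrr.
  move=> k /andP[k1 kd]; congr (br u v _ _); rewrite gT; last by lia.
  by congr T; lia.
have homj : laurent_homog h j%:Z (tofrac (Gc j) - T j%:Z).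
  apply: (laurent_homogD hh h0); first by apply/laurent_homog_tofrac/hGc; lia.
  apply: laurent_homogN; apply: (laurent_homog_sum hh h0) => m _.
  apply/laurent_homogZ/laurent_homog_fppart => //.
  move=> k; apply/laurent_homog_tofrac/hFc.
  by have := ltn_ord k; lia.
have [u v|c cE] := laurent_parallel_gradient hh h0 homj.
  (* The nonzero factor d h^(d-1) cancels, leaving parallel gradients. *)
  have := brx u v; rewrite /br fd !(derivXn (@fderiv_derivation n K _)) /=.
  set x := _ - T _; rewrite -!mulrA -!mulrBr => /eqP.
  rewrite !mulf_eq0 expf_eq0 (negbTE H0) andbF /=.
  rewrite -(rmorph_nat (@fracC n K)) fmorph_eq0 pnatr_eq0 /= subr_eq0.
  by move/eqP.
(* Only the value at j changes, so the formulas for larger indices, which involve a_m with m > j,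
   survive. *)
exists (fun z => if z == j%:Z then c else a z); split.
  by rewrite ifN // eqz_nat neq_ltn jN orbT.
move=> l /andP[]; rewrite -/j leq_eqVlt => /orP[/eqP <- _|jl lN].
  rewrite big_ltn; last exact: ltnW.
  rewrite eqxx fppart_diag -cE.
  rewrite (eq_big_nat _ _ (F2 := fun m => fracC (a m%:Z) * part m%:Z j%:Z)).
    by rewrite subrK.
  by move=> m /andP[jm _]; rewrite ifN // eqz_nat neq_ltn jm orbT.
rewrite ga; last by move: jl lN; rewrite /j; lia.
apply: eq_big_nat => m /andP[lm _]; rewrite ifN // eqz_nat.
by apply: contraTneq lm => ->; rewrite -ltnNge.
Qed.

End DescendingInduction.

(** * The sum over exponents *)

Section ExponentSum.
Variables (s N j : nat).
Local Notation d := s.+1.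

Definition exponent_of (al : 'X_{1..s}) : exponent s :=
  (j%:Z - (\sum_(k < s) k.+1 * al k)%N%:Z, [ffun k => al k]).

Lemma etotal_exponent_of al : etotal (exponent_of al) = mdeg al.
Proof. by rewrite /etotal mdegE; apply: eq_bigr => k _; rewrite ffunE. Qed.

(** Each variable contributes (k + 1) + (s - k) = d. *)
Lemma mcodegE (al : 'X_{1..s}) :
  (\sum_(k < s) k.+1 * al k + mcodeg al = d * mdeg al)%N.
Proof.
rewrite /mcodeg mdegE big_distrr -big_split /=; apply: eq_bigr => k _.
by rewrite -mulnDl; congr muln; have := ltn_ord k; lia.
Qed.

Lemma eindex_exponent_of al : eindex d (exponent_of al) = (j + mcodeg al)%N.
Proof.
by rewrite /eindex etotal_exponent_of -mcodegE /exponent_of /=; lia.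
Qed.

Lemma exponent_of_bij :
  set_bij [set` [pred al : 'X_{1..s < N.+1} | j + mcodeg al <= N]%N]
    (exponents d N j) (fun al => exponent_of (bmnm al)).
Proof.
split.
- move=> al /=; rewrite inE => jN; split; last by rewrite eindex_exponent_of lez_nat.
  rewrite /eweight /=; under [X in _ + X%:Z]eq_bigr => k _ do rewrite ffunE.
  by rewrite subrK.
- move=> al be _ _ [_ /ffunP e]; apply/val_inj/mnmP => k /=.
  by have := e k; rewrite !ffunE.
- move=> [z v] al; have tal := exponents_total (leqnn s.+1) al.
  pose be := [multinom v k | k < s].
  have beE k : fun_of_multinom be k = v k by rewrite multinomE tnth_mktuple.
  (* [exponents_total] bounds the total by N, so the exponent lies in the finite box. *)
  have beN : (mdeg be < N.+1)%N.
    rewrite mdegE ltnS (leq_trans _ tal) // (leq_trans _ (leq_addl _ _)) //.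
    by rewrite /etotal; apply: leq_sum => k _; rewrite beE.
  have vE : (z, v) = exponent_of be.
    case: al => + _; rewrite /eweight /exponent_of /= => <-.
    congr pair; last by apply/ffunP => k; rewrite ffunE beE.
    rewrite [X in _ - X%:Z](eq_bigr (fun k : 'I_s => k.+1 * v k)%N) ?addrK //.
    by move=> k _; rewrite beE.
  exists (BMultinom beN); last by rewrite vE.
  by rewrite /= inE -lez_nat -eindex_exponent_of -vE; case: al.
Qed.

End ExponentSum.

Section FractionalPowerSum.
Variables (n : nat) (K : numFieldType) (s N j : nat).
Variables (Fc : nat -> {mpoly K[n]}) (h : {mpoly K[n]}) (a : int -> K).
Hypothesis h0 : h != 0.
Local Notation d := s.+1.
Local Notation H := (tofrac h).
Local Notation part m j := (fppart s (@fracC n K) H (fun k => tofrac (Fc k)) m j).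

(** A monomial [al] occurs for a single m, namely m = j + [mcodeg al], which is its [eindex];
    exchanging the sums therefore leaves one term per exponent. *)
Lemma fppart_sumE :
  \sum_(j <= m < N.+1) fracC (a m%:Z) * part m%:Z j%:Z =
  \sum_(al \in exponents d N j : set (exponent s))
    tofrac (ecoef d a al *: \prod_(k < s) Fc k.+1 ^+ al.2 k) * H ^ al.1.
Proof.
have H0 : H != 0 by rewrite tofrac_eq0.
rewrite (reindex_fsbig _ _ _ _ (exponent_of_bij s N j)).
rewrite -(bigfs _ (r := index_enum _)) ?index_enum_uniq //; last first.
  by move=> al _; rewrite mem_index_enum.
pose X m (al : 'X_{1..s}) := fracC (a m%:Z) * (H ^ m%:Z * (fracC (fpcoef K m al) *
   mmap1 (fun k : 'I_s => tofrac (Fc k.+1) / H ^+ d) al)).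
transitivity (\sum_(j <= m < N.+1) \sum_(al : 'X_{1..s < N.+1})
   if (m == j + mcodeg al)%N then X m al else 0).
  apply: eq_big_nat => m /andP[jm mN]; rewrite /fppart (@fppoly_widen _ _ N.+1).
    rewrite raddf_sum !mulr_sumr; apply: eq_bigr => al _ /=.
    rewrite mmapZ mmapX.
    have -> : ((mcodeg al)%:Z == m%:Z - j%:Z) = (m == j + mcodeg al)%N.
      by apply/eqP/eqP; lia.
    by case: ifP => // _; rewrite rmorph0 mul0r !mulr0.
  by lia.
rewrite exchange_big [in RHS]big_mkcond /=; apply: eq_bigr => al _.
rewrite -big_mkcond big_nat1_eq leq_addr /= ltnS; case: ifP => // jN.
move: (bmnm al) jN => {}al _; rewrite /X /ecoef eindex_exponent_of etotal_exponent_of.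
(* That is, alpha_0 = m - d |al|, so the denominators h^d turn h^m into h^alpha_0. *)
have eE : j%:Z - (\sum_(k < s) k.+1 * al k)%N%:Z =
    (j + mcodeg al)%N%:Z - (d * mdeg al)%N%:Z by rewrite -mcodegE !PoszD; ring.
have -> : mmap1 (fun k : 'I_s => tofrac (Fc k.+1) / H ^+ d) al =
    tofrac (\prod_(k < s) Fc k.+1 ^+ al k) / H ^+ (d * mdeg al).
  rewrite /mmap1 (rmorph_prod (@tofrac _)) mdegE exprM expr_sum -prodf_div.
  by apply: eq_bigr => k _; rewrite expr_div_n /= tofracXn.
rewrite eE expfzDr // -exprnN -mul_mpolyC tofracM.
have fracCE c : tofrac (c%:MP) = fracC c by [].
rewrite fracCE [X in _ = X * _ * _](rmorphM fracC).
have -> : \prod_(k < s) Fc k.+1 ^+ [ffun k => al k] k =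
    \prod_(k < s) Fc k.+1 ^+ al k by apply: eq_bigr => k _; rewrite ffunE.
rewrite [X in fracC X * fracC _](_ : _ = fpcoef K (j + mcodeg al)%N al); last first.
  rewrite /fpcoef /exponent_of /= eE; congr (_ / _).
  by apply: eq_bigr => k _; rewrite ffunE.
move: (fracC _) (fracC _) (tofrac _) (H ^ _) (_^-1) => A B C D E.
by ring.
Qed.

End FractionalPowerSum.

(** * Components of the Poisson bracket *)

Section BracketComponents.
Variables (n : nat) (K : numFieldType) (d N : nat).
Variables (Fc Gc : nat -> {mpoly K[n]}).
Hypotheses (hFc : forall k, (1 <= k <= d)%N -> Fc k \is k.-homog).
Hypotheses (hGc : forall k, (1 <= k <= N)%N -> Gc k \is k.-homog).

Lemma poisson_degree_mdeg (w : 'M[{mpoly K[n]}]_n) e (i j : 'I_n) m :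
  (i < j)%N -> (poisson_degree w < e%:Z%:E)%E -> m \in msupp (w i j) ->
  ((mdeg m).+2 < e)%N.
Proof.
move=> ij lte mw; rewrite -ltz_nat -lte_fin; apply: le_lt_trans lte.
have -> : ((mdeg m).+2%:Z)%:E = (2%:Z%:E + (mdeg m)%:Z%:E)%E :> \bar int.
  by rewrite -EFinD.
rewrite leeD2l //; apply: (@le_trans _ _ (pdegree (w i j))).
  rewrite /pdegree ifN; last by apply: contraTneq mw => ->; rewrite msupp0.
  by rewrite lee_fin lez_nat -ltnS (leq_trans (msize_mdeg_lt mw)) ?leqSpred.
apply: le_trans (le_bigmax_cond _ _ ij) (le_bigmax _ _ i).
Qed.

(** The entry of [F_k, G_l] is homogeneous of degree k + l - 2, so the sum is the component of
    degree d + j - 2 of an entry of [F, G]. It vanishes because d + j is at least d + i. *)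
Lemma poisson_component (i j : nat) (a b : 'I_n) :
  (1 <= d)%N -> (1 <= i)%N -> (i <= j)%N ->
  (poisson_degree (poisson (\sum_(1 <= k < d.+1) Fc k)
    (\sum_(1 <= k < N.+1) Gc k)) < (d + i)%N%:Z%:E)%E ->
  \sum_(1 <= k < d.+1)
     ((Fc k)^`M(a) * (if (1 <= d + j - k <= N)%N then Gc (d + j - k) else 0)^`M(b)
    - (Fc k)^`M(b) * (if (1 <= d + j - k <= N)%N then Gc (d + j - k) else 0)^`M(a))
  = 0.
Proof.
move=> d1 i1 ij hdeg.
(* The degree only sees entries above the diagonal; antisymmetry gives the rest. *)
wlog ab : a b / (a < b)%N.
  move=> IH; have [ab|ba|/val_inj ->] := ltngtP a b; first exact: IH.
    apply/eqP; rewrite -oppr_eq0 -sumrN; apply/eqP; rewrite -[RHS](IH b a ba).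
    by apply: eq_bigr => k _; rewrite opprB.
  by rewrite big1 // => k _; rewrite subrr.
set F := \sum_(1 <= k < d.+1) _ in hdeg.
set G := \sum_(1 <= k < N.+1) _ in hdeg.
pose W k l := (Fc k)^`M(a) * (Gc l)^`M(b) - (Fc k)^`M(b) * (Gc l)^`M(a).
have WE : poisson F G a b = \sum_(1 <= k < d.+1) \sum_(1 <= l < N.+1) W k l.
  rewrite poissonE // /F /G !linear_sum !mulr_suml -sumrB.
  by apply: eq_bigr => k _; rewrite !mulr_sumr -sumrB.
have Whom k l : (1 <= k <= d)%N -> (1 <= l <= N)%N -> W k l \is (k + l - 2).-homog.
  move=> kd lN; have -> : (k + l - 2 = k.-1 + l.-1)%N by lia.
  by apply: rpredB; apply: dhomogM; apply: dhomog_mderiv; auto.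
have W0 : pihomog mdeg (d + j - 2) (poisson F G a b) = 0.
  rewrite pihomogE big_seq_cond big1 // => m /andP[mW /eqP mE].
  have := poisson_degree_mdeg ab hdeg mW.
  have {}mE : mdeg m = (d + j - 2)%N by [].
  by rewrite mE; lia.
apply: etrans W0; rewrite WE linear_sum; apply: eq_big_nat => k /andP[k1 kd].
(* The projection keeps only l = d + j - k; if this lies outside 1..N, both sides are zero. *)
rewrite linear_sum /= (eq_big_nat _ _
    (F2 := fun l => if l == (d + j - k)%N then W k l else 0)).
  rewrite -big_mkcond big_nat1_eq ltnS; case: ifP => // _.
  by rewrite !mderiv0 !mulr0 subrr.
move=> l /andP[l1 lN]; have hW : W k l \is (k + l - 2).-homog.
  by apply: Whom; lia.
have [e|ne] := eqVneq l (d + j - k)%N.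
  by apply: pihomog_dE; have -> : (d + j - 2 = k + l - 2)%N by lia.
by apply: pihomog_ne0 hW; apply: contraNneq ne => e; apply/eqP; lia.
Qed.

End BracketComponents.

Theorem theorem4p1 (R : realType) (n d N : nat) (hd : (1 <= d)%N)
  (hN : (1 <= N)%N) (Fc Gc : nat -> {mpoly R[i][n]}) (F G h : {mpoly R[i][n]})
  (aN : R[i])
  (hFc : forall k, (1 <= k <= d)%N -> Fc k \is k.-homog)
  (hGc : forall k, (1 <= k <= N)%N -> Gc k \is k.-homog)
  (hF : F = \sum_(1 <= k < d.+1) Fc k)
  (hG : G = \sum_(1 <= k < N.+1) Gc k)
  (hh : h \is 1.-homog) (hh0 : h != 0) (haN : aN != 0)
  (hFd : Fc d = h ^+ d) (hGN : Gc N = aN *: h ^+ N)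
  (i : nat) (hi : (1 <= i <= N)%N)
  (hdeg : (poisson_degree (poisson F G) < (d + i)%N%:Z%:E)%E) :
  exists a : int -> R[i], a N%:Z = aN /\
    forall j : nat, (i <= j <= N)%N ->
      tofrac (Gc j) =
        \sum_(al \in exponents d N j : set (exponent d.-1))
          tofrac (ecoef d a al *: \prod_(k < d.-1) Fc k.+1 ^+ al.2 k)
          * tofrac h ^ al.1.
Proof.
case: d hd hFc hF hFd hdeg => // s _ hFc' hF' hFd' hdeg'.
have [i0 iN] := andP hi.
have [|a [aNE ga]] := component_eq_fppart_sum hh hh0 hFc' hFd' hi hGN hGc.
  (* The degree bound yields the vanishing brackets required by the descending induction. *)
  move=> j ij u v; apply: (poisson_component hFc' hGc u v (ltn0Sn s) i0 ij).
  by rewrite -hF' -hG.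
by exists a; split=> // j ij; rewrite ga // fppart_sumE.
Qed.
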